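(* Let $V$ be an affine variety and let $f:V\to V$ be a morphism. Let $\iota_1:V\to\mathbb{A}^{N_1}$ and $\iota_2:V\to\mathbb{A}^{N_2}$ be two affine embeddings of $V$. For $i=1,2$ let $g_i:\mathbb{A}^{N_i}\to\mathbb{A}^{N_i}$ be a morphism such that $g_i(\iota_i(V))=\iota_i(V)$ and $\iota_i^*(g_i)=f$, i.e. $g_i\circ\iota_i=\iota_i\circ f$. Then $$\mathrm{e}_{\mathrm{alg}}(g_1;\iota_1(V))=\mathrm{e}_{\mathrm{alg}}(g_2;\iota_2(V)).$$
   Context: An affine embedding is a closed embedding into affine space, so that its coordinate functions generate the ring of regular functions of $V$. The degree of a morphism $\mathbb{A}^N\to\mathbb{A}^M$ is the maximal degree of its coordinate polynomials. For a subvariety $W\subset\mathbb{A}^N$ and a morphism $h:\mathbb{A}^N\to\mathbb{A}^M$, the degree of $h$ relative to $W$ is $$\deg(h;W)=\min\{\deg(g) : g:\mathbb{A}^N\to\mathbb{A}^M\text{ a morphism with } g|_W=h|_W\}.$$ For a morphism $h:\mathbb{A}^N\to\mathbb{A}^N$, the algebraic entropy of $h$ relative to $W$ is $$\mathrm{e}_{\mathrm{alg}}(h;W)=\limsup_{n\to\infty}\frac1n\log\deg(h^{\circ n};W),$$ where $h^{\circ n}$ is the $n$-th iterate of $h$. *)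

(* Defs.v *)
From HB Require Import structures.
From mathcomp Require Import all_boot all_order all_algebra.
From mathcomp Require Import boolp classical_sets functions.
From mathcomp Require Import reals constructive_ereal ereal topology sequences.
From mathcomp Require Import exp.
(* The notations of mpoly clash with those of mathcomp-analysis. *)
From mathcomp Require Import -(notations) mpoly.

Set Implicit Arguments.
Unset Strict Implicit.
Unset Printing Implicit Defensive.

Import Order.TTheory GRing.Theory Num.Theory.

Local Open Scope classical_set_scope.
Local Open Scope ring_scope.

(* The points of affine N-space over k are the row vectors 'rV[k]_N. *)

Definition peval (k : closedFieldType) (N : nat) (p : mpoly N k)
    (x : 'rV[k]_N) : k :=
  meval (fun i => x ord0 i) p.

Definition zariski_closed (k : closedFieldType) (N : nat)
    (X : set 'rV[k]_N) : Prop :=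
  exists S : set (mpoly N k), X = [set x | forall p, S p -> peval p x = 0].

(* A subset X is coerced to the type {x | x \in X} of its points, so that
   functions on X need not be defined outside of X. *)
Definition regular_function (k : closedFieldType) (N : nat)
    (X : set 'rV[k]_N) (phi : X -> k) : Prop :=
  exists p : mpoly N k, forall x : X, phi x = peval p (val x).

Definition regular_map (k : closedFieldType) (N M : nat)
    (X : set 'rV[k]_N) (f : X -> 'rV[k]_M) : Prop :=
  forall j : 'I_M, regular_function (fun x => f x ord0 j).

Definition variety_morphism (k : closedFieldType) (N M : nat)
    (X : set 'rV[k]_N) (Y : set 'rV[k]_M) (f : X -> Y) : Prop :=
  regular_map (fun x => val (f x)).

Definition corestrict (T U : Type) (f : T -> U) (x : T) : range f :=
  SigSub (mem_set (imageT f x)).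

(* A morphism to affine space whose image is closed and which is an isomorphism
   onto its image.  A left inverse r of the corestriction is a two-sided
   inverse, because the corestriction is surjective. *)
Definition affine_embedding (k : closedFieldType) (n N : nat)
    (V : set 'rV[k]_n) (iota : V -> 'rV[k]_N) : Prop :=
  [/\ regular_map iota,
      zariski_closed (range iota) &
      exists2 r : range iota -> V,
        variety_morphism r & cancel (corestrict iota) r].

Definition polymap (k : closedFieldType) (N M : nat) : Type :=
  M.-tuple (mpoly N k).

Definition polymap_eval (k : closedFieldType) (N M : nat)
    (g : polymap k N M) (x : 'rV[k]_N) : 'rV[k]_M :=
  \row_j peval (tnth g j) x.

Definition polymap_id (k : closedFieldType) (N : nat) : polymap k N N :=
  [tuple mpolyX k (mnm1 i) | i < N].

Definition polymap_comp (k : closedFieldType) (N M L : nat)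
    (g : polymap k M L) (h : polymap k N M) : polymap k N L :=
  [tuple comp_mpoly h (tnth g j) | j < L].

Definition polymap_iter (k : closedFieldType) (N : nat) (g : polymap k N N)
    (n : nat) : polymap k N N :=
  iter n (polymap_comp g) (polymap_id k N).

(* The size of a polynomial is its degree plus one; the zero polynomial is given
   degree 0. *)
Definition polymap_degree (k : closedFieldType) (N M : nat)
    (g : polymap k N M) : nat :=
  \max_(j < M) (msize (tnth g j)).-1.

Definition is_degree_on (k : closedFieldType) (N M : nat)
    (W : set 'rV[k]_N) (h : polymap k N M) (d : nat) : bool :=
  `[< exists g : polymap k N M,
        (forall x, W x -> polymap_eval g x = polymap_eval h x) /\
        polymap_degree g = d >].

Lemma is_degree_on_ex (k : closedFieldType) (N M : nat)
    (W : set 'rV[k]_N) (h : polymap k N M) :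
  exists d, is_degree_on W h d.
Proof. by exists (polymap_degree h); apply/asboolP; exists h. Qed.

Definition rel_degree (k : closedFieldType) (N M : nat)
    (h : polymap k N M) (W : set 'rV[k]_N) : nat :=
  ex_minn (is_degree_on_ex W h).

(* Extended-real valued: lne 0 = -oo, which matters only when some iterate of h
   is constant on W.  The term of index 0 does not affect the upper limit. *)
Definition algebraic_entropy (R : realType) (k : closedFieldType) (N : nat)
    (h : polymap k N N) (W : set 'rV[k]_N) : \bar R :=
  limn_esup (fun n : nat =>
    ((n%:R^-1)%:E * lne ((rel_degree (polymap_iter h n) W)%:R)%:E)%E).

(* Main.v *)
(** Since each [iota_i] is a closed embedding, there are polynomial maps [P] and
    [Q] with [P o iota1 = iota2] and [Q o iota2 = iota1].  If [h] agrees with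
    [g1^m] on [iota1(V)], then [P o h o Q] agrees with [g2^m] on [iota2(V)], so
    [deg (g2^m; iota2(V)) <= deg P * deg Q * deg (g1^m; iota1(V))], where the
    constant does not depend on [m].  After taking logarithms and dividing by
    [m], this constant disappears in the upper limit.  Exchanging the roles of
    the two embeddings gives the converse inequality. *)
Require Import Defs.
From mathcomp Require Import all_boot all_order all_algebra.
From mathcomp Require Import boolp classical_sets reals constructive_ereal.
From mathcomp Require Import ereal normedtype sequences exp.
From mathcomp Require Import -(notations) mpoly.

Set Implicit Arguments.
Unset Strict Implicit.
Unset Printing Implicit Defensive.

Import Order.TTheory GRing.Theory Num.Theory.

Local Open Scope classical_set_scope.
Local Open Scope ring_scope.

(** Over a field, degrees add for nonzero factors. A zero factor makes the product zero, of degree 0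
    by convention, hence only an inequality. *)
Lemma msize_prod_pred (k : fieldType) (n : nat) (I : Type) (r : seq I)
    (F : I -> mpoly n k) :
  ((msize (\prod_(i <- r) F i)).-1 <= \sum_(i <- r) (msize (F i)).-1)%N.
Proof.
elim/big_rec2: _ => [|i s p _ IH]; first by rewrite msize1.
have [->|F0] := eqVneq (F i) 0; first by rewrite mul0r msize0.
have [->|p0] := eqVneq p 0; first by rewrite mulr0 msize0.
rewrite msizeM//; move: IH.
by rewrite (mpolySpred _ F0) (mpolySpred _ p0) /= addnS leq_add2l.
Qed.

Lemma msize_exp_pred (k : fieldType) (n : nat) (p : mpoly n k) (e : nat) :
  ((msize (p ^+ e)).-1 <= e * (msize p).-1)%N.
Proof.
have := msize_prod_pred (index_enum 'I_e) (fun=> p).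
by rewrite prodr_const sum_nat_const card_ord.
Qed.

Section PolynomialMaps.
Variable k : closedFieldType.

(** Each monomial [m] of [p] becomes a product of the powers [h_i ^ m_i], whose degree is at most
    [mdeg m] times the degree of [h]. *)
Lemma msize_comp_mpoly (N M : nat) (p : mpoly M k) (h : polymap k N M) :
  ((msize (comp_mpoly h p)).-1 <= (msize p).-1 * polymap_degree h)%N.
Proof.
(* The sum is bounded by sizes; for each single monomial the proof then returns to degrees. *)
rewrite comp_mpolyE -subn1 leq_subLR add1n.
apply: leq_trans (msize_sum _ _ _) _; apply/bigmax_leqP_seq => m mp _.
apply: leq_trans (msizeZ_le _ _) _.
rewrite -add1n -leq_subLR subn1.
apply: leq_trans (msize_prod_pred _ _) _.
apply: (@leq_trans (mdeg m * polymap_degree h)); last first.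
  have mp_lt := msize_mdeg_lt mp.
  by rewrite leq_mul2r -ltnS prednK ?mp_lt ?orbT// (leq_trans _ mp_lt).
rewrite mdegE big_distrl /=; apply: leq_sum => i _.
apply: leq_trans (msize_exp_pred _ _) _.
by rewrite leq_mul2l /polymap_degree (leq_bigmax i) orbT.
Qed.

Lemma polymap_degree_comp (N M L : nat) (g : polymap k M L)
    (h : polymap k N M) :
  (polymap_degree (polymap_comp g h) <= polymap_degree g * polymap_degree h)%N.
Proof.
apply/bigmax_leqP => j _; rewrite tnth_mktuple.
apply: leq_trans (msize_comp_mpoly _ _) _.
by rewrite leq_mul2r /polymap_degree (leq_bigmax j) orbT.
Qed.

Lemma peval_comp (N M : nat) (p : mpoly M k) (h : polymap k N M)
    (x : 'rV[k]_N) :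
  peval (comp_mpoly h p) x = peval p (polymap_eval h x).
Proof.
by rewrite /peval comp_mpoly_meval; apply: meval_eq => i; rewrite mxE.
Qed.

Lemma polymap_eval_comp (N M L : nat) (g : polymap k M L)
    (h : polymap k N M) (x : 'rV[k]_N) :
  polymap_eval (polymap_comp g h) x = polymap_eval g (polymap_eval h x).
Proof. by apply/rowP => j; rewrite !mxE tnth_mktuple peval_comp. Qed.

Lemma polymap_eval_id (N : nat) (x : 'rV[k]_N) :
  polymap_eval (polymap_id k N) x = x.
Proof.
by apply/rowP => j; rewrite !mxE tnth_mktuple /peval mevalXU.
Qed.

Lemma polymap_eval_iter (T : Type) (N : nat) (f : T -> T)
    (iota : T -> 'rV[k]_N) (g : polymap k N N) :
  (forall x, polymap_eval g (iota x) = iota (f x)) ->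
  forall n x, polymap_eval (polymap_iter g n) (iota x) = iota (iter n f x).
Proof.
move=> gf; elim=> [|n IH] x; first by rewrite polymap_eval_id.
by rewrite [polymap_iter _ _]iterS polymap_eval_comp -/(polymap_iter g n) IH gf.
Qed.

Lemma regular_mapP (N M : nat) (X : set 'rV[k]_N) (f : X -> 'rV[k]_M) :
  regular_map f -> exists P : polymap k N M,
    forall x, polymap_eval P (val x) = f x.
Proof.
move=> /choice[p fp]; exists [tuple p j | j < M] => x.
by apply/rowP => j; rewrite mxE tnth_mktuple fp.
Qed.

(** The inverse of [iota] on its image extends to a polynomial map [Q], and [phi] to a polynomial
    map on the space containing [V]; compose the two. *)
Lemma embedding_factor (n N M : nat) (V : set 'rV[k]_n)
    (iota : V -> 'rV[k]_N) (phi : V -> 'rV[k]_M) :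
  affine_embedding iota -> regular_map phi ->
  exists P : polymap k N M, forall x, polymap_eval P (iota x) = phi x.
Proof.
case=> _ _ [r /regular_mapP[Q rQ] rK] /regular_mapP[P phiP].
exists (polymap_comp P Q) => x.
rewrite polymap_eval_comp -phiP; congr polymap_eval.
by rewrite -[in RHS](rK x) -rQ.
Qed.

Lemma rel_degreeP (N M : nat) (h : polymap k N M) (W : set 'rV[k]_N) :
  exists2 g : polymap k N M,
    forall x, W x -> polymap_eval g x = polymap_eval h x &
    polymap_degree g = rel_degree h W.
Proof.
by rewrite /rel_degree; case: ex_minnP => d /asboolP[g [gh <-]] _; exists g.
Qed.

Lemma rel_degree_le (N M : nat) (g h : polymap k N M) (W : set 'rV[k]_N) :
  (forall x, W x -> polymap_eval g x = polymap_eval h x) ->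
  (rel_degree h W <= polymap_degree g)%N.
Proof.
move=> gh; rewrite /rel_degree; case: ex_minnP => d _; apply.
by apply/asboolP; exists g.
Qed.

(** An arbitrary self-map [f] is allowed, so that every iterate can take its place while [P] and [Q]
    stay the same. *)
Lemma rel_degree_transport (T : Type) (N1 N2 : nat) (f : T -> T)
    (iota1 : T -> 'rV[k]_N1) (iota2 : T -> 'rV[k]_N2)
    (P : polymap k N1 N2) (Q : polymap k N2 N1)
    (h1 : polymap k N1 N1) (h2 : polymap k N2 N2) :
  (forall x, polymap_eval P (iota1 x) = iota2 x) ->
  (forall x, polymap_eval Q (iota2 x) = iota1 x) ->
  (forall x, polymap_eval h1 (iota1 x) = iota1 (f x)) ->
  (forall x, polymap_eval h2 (iota2 x) = iota2 (f x)) ->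
  (rel_degree h2 (range iota2) <=
   polymap_degree P * polymap_degree Q * rel_degree h1 (range iota1))%N.
Proof.
move=> P12 Q21 h1f h2f; have [g gh <-] := rel_degreeP h1 (range iota1).
apply: (@leq_trans (polymap_degree (polymap_comp P (polymap_comp g Q)))).
  apply: rel_degree_le => _ [x _ <-].
  (* The composite sends [iota2 x] to [iota1 x], then to [iota1 (f x)], then to [iota2 (f x)]. *)
  rewrite !polymap_eval_comp Q21 gh; last exact: imageT.
  by rewrite h1f P12 h2f.
apply: leq_trans (polymap_degree_comp _ _) _.
by rewrite -mulnA leq_mul2l (mulnC (polymap_degree Q)) polymap_degree_comp orbT.
Qed.

End PolynomialMaps.

Section UpperLimits.
Variable R : realType.
Local Open Scope ereal_scope.

(** The upper limit is the infimum over [A] in [F] of the suprema over [A]. Shrinking [A] to the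
    points where [v <= u + e] keeps it in [F] and bounds the supremum of [v] there by that of [u]
    over [A], plus [e]. *)
Lemma le_limf_esup_eps (T : choiceType) (X : filteredType T) (F : set (set X))
    (FF : Filter F) (u v : X -> \bar R) :
  (forall e : R, (0 < e)%R -> F [set x | v x <= u x + e%:E]) ->
  limf_esup v F <= limf_esup u F.
Proof.
move=> vu; apply/lee_addgt0Pr => e e0; rewrite -leeBlDr//.
apply: le_ereal_inf_tmp => _ [A FA <-]; rewrite leeBlDr//.
pose B := A `&` [set x | v x <= u x + e%:E].
have FB : F B by apply: filterI => //; exact: vu.
apply: (@le_trans _ _ (ereal_sup (v @` B))).
  by apply: ereal_inf_lbound; exists B.
apply: ge_ereal_sup => _ [x [Ax /= vx] <-]; apply: le_trans vx _.
by rewrite leeD2r//; apply: ereal_sup_ubound; exists x.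
Qed.

Lemma limn_esup_log_le (c : nat) (a b : nat -> nat) :
  (forall n, b n <= c * a n)%N ->
  limn_esup (fun n => (n%:R^-1)%:E * lne ((b n)%:R)%:E : \bar R) <=
  limn_esup (fun n => (n%:R^-1)%:E * lne ((a n)%:R)%:E).
Proof.
move=> ba; apply: le_limf_esup_eps => e e0.
pose K := `|ln (c%:R : R)|%R.
(* Beyond this threshold [n] is positive and exceeds [K / e], so the error [ln c / n] is at most
   [e]. *)
exists (Num.truncn (K / e)).+1 => // n ltn; rewrite /mkset.
have n0 : (0 < n%:R :> R)%R by rewrite ltr0n (leq_trans _ ltn).
(* If [b n = 0], the left side is [-oo]. Otherwise [c] and [a n] are positive too, and all
   logarithms are finite. *)
have [bn0|] := posnP (b n).
  by rewrite bn0 le0_lneNy// gt0_muleNy ?leNye// lte_fin invr_gt0.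
move=> b0; have := leq_trans b0 (ba n); rewrite muln_gt0 => /andP[c0 a0].
rewrite !lne_EFin ?ltr0n// -!EFinM -EFinD lee_fin.
have /ltW Ke : (K < e * n%:R)%R.
  rewrite mulrC -ltr_pdivrMr//; apply: lt_le_trans (truncnS_gt _) _.
  by rewrite ler_nat.
rewrite ler_pdivrMl// mulrDr mulVKf ?gt_eqF//.
(* After multiplication by [n], the goal is [ln (b n) <= ln (a n) + n * e]. *)
apply: (@le_trans _ _ (ln (c%:R * (a n)%:R : R))).
  by rewrite ler_ln ?posrE ?mulr_gt0 ?ltr0n// -natrM ler_nat.
rewrite lnM ?posrE ?ltr0n// addrC lerD2l mulrC.
exact: le_trans (ler_norm _) Ke.
Qed.

End UpperLimits.

Lemma algebraic_entropy_le (R : realType) (k : closedFieldType)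
    (n N1 N2 : nat) (V : set 'rV[k]_n) (f : V -> V)
    (iota1 : V -> 'rV[k]_N1) (iota2 : V -> 'rV[k]_N2)
    (g1 : polymap k N1 N1) (g2 : polymap k N2 N2) :
  affine_embedding iota1 -> affine_embedding iota2 ->
  (forall x, polymap_eval g1 (iota1 x) = iota1 (f x)) ->
  (forall x, polymap_eval g2 (iota2 x) = iota2 (f x)) ->
  (algebraic_entropy R g2 (range iota2) <=
   algebraic_entropy R g1 (range iota1))%E.
Proof.
move=> emb1 emb2 g1f g2f.
have [reg1 _ _] := emb1; have [reg2 _ _] := emb2.
(* [P] and [Q] are fixed before the iterate [m], so the product of their degrees serves as one
   constant for all [m]. *)
have [P P12] := embedding_factor emb1 reg2.
have [Q Q21] := embedding_factor emb2 reg1.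
apply: limn_esup_log_le => m.
exact: rel_degree_transport P12 Q21 (polymap_eval_iter g1f m)
  (polymap_eval_iter g2f m).
Qed.

Theorem proposition3p1 (R : realType) (k : closedFieldType) (n N1 N2 : nat)
    (V : set 'rV[k]_n) (hV : zariski_closed V)
    (f : V -> V) (hf : variety_morphism f)
    (iota1 : V -> 'rV[k]_N1) (hiota1 : affine_embedding iota1)
    (iota2 : V -> 'rV[k]_N2) (hiota2 : affine_embedding iota2)
    (g1 : polymap k N1 N1)
    (himg1 : polymap_eval g1 @` range iota1 = range iota1)
    (hg1 : forall x : V, polymap_eval g1 (iota1 x) = iota1 (f x))
    (g2 : polymap k N2 N2)
    (himg2 : polymap_eval g2 @` range iota2 = range iota2)
    (hg2 : forall x : V, polymap_eval g2 (iota2 x) = iota2 (f x)) :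
  algebraic_entropy R g1 (range iota1) = algebraic_entropy R g2 (range iota2).
Proof.
by apply/eqP; rewrite eq_le; apply/andP; split;
  apply: algebraic_entropy_le; eassumption.
Qed.
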